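(* For integers $i \ge 4$ and $m,k \ge 4$ define $$w_4(m,k) = \binom{m+k-6}{k-2} + \binom{m+k-7}{k-3} + 2\binom{m+k-8}{k-4},$$ and for $i \ge 5$, $w_i(m,k) = 0$ if $k < i$ and $w_i(m,k) = (i-1)\binom{m+k-i-4}{k-i}$ if $k \ge i$. Let $g(m,l) = \sum_{i=4}^{\infty} w_i(m,l)$. Then for all $m \ge 4$, $l \ge 4$, every $(m,l)$-free set $S$ of more than $g(m,l)$ points contains an $(m,l)$-good point $s$, and this point $s$ is moreover the left endpoint of an $(l-1)$-cap.
   Context: All point sets are finite sets in the plane in general position (no three collinear), with pairwise distinct $x$-coordinates. A set of $n$ points, listed as $(x_1,y_1),\dots,(x_n,y_n)$ with $x_1<\dots<x_n$, is an $n$-cup if $\frac{y_2-y_1}{x_2-x_1} < \dots < \frac{y_n-y_{n-1}}{x_n-x_{n-1}}$, and an $n$-cap if $\frac{y_2-y_1}{x_2-x_1} > \dots > \frac{y_n-y_{n-1}}{x_n-x_{n-1}}$. Its left (right) endpoint is the point with smallest (largest) $x$-coordinate. A set is $(n,m)$-free if it contains no $n$-cup and no $m$-cap. Given a set $S$ and $s\in S$, $s$ is called $(m,l)$-good if for every $n\ge 4$ the following holds: whenever a set $B$ with $|B|\le n-2$ is adjoined to $S$ such that $S\cup B$ contains an $(n-1)$-cup whose left endpoint is $s$ and whose right endpoint lies in $B$, then $S\cup B$ contains an $l$-cap whose two rightmost points belong to $S$, or an $m$-cup whose two leftmost points belong to $S$, or $n$ points forming a convex $n$-gon. *)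

(* Defs.v *)
From mathcomp Require Import all_boot all_order all_algebra finmap.
From mathcomp Require Import classical_sets fsbigop reals.

Set Implicit Arguments.
Unset Strict Implicit.
Unset Printing Implicit Defensive.

Import Order.TTheory GRing.Theory Num.Theory.

Section PointSets.
Local Open Scope ring_scope.
Local Open Scope fset_scope.
Variable R : realType.
Implicit Types (p q r s : R * R) (c : seq (R * R)) (S B X : {fset R * R}).

Definition collinear p q r : Prop :=
  (q.1 - p.1) * (r.2 - p.2) = (r.1 - p.1) * (q.2 - p.2).

(* The standing assumption on point sets: no three points are collinear and
   the x-coordinates are pairwise distinct. *)
Definition general_position S : Prop :=
  (forall p q r, p \in S -> q \in S -> r \in S ->
     p != q -> p != r -> q != r -> ~ collinear p q r) /\
  {in S &, injective fst}.

Definition slope p q : R := (q.2 - p.2) / (q.1 - p.1).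

Definition slopes c : seq R :=
  if c is p :: c' then pairmap slope p c' else [::].

(* A cup or cap is represented by the list of its points in increasing order
   of x-coordinate, so that its left and right endpoints are the first and the
   last entry of the list. *)
Definition is_cup (n : nat) c : Prop :=
  [/\ size c = n, sorted <%R (map fst c) & sorted <%R (slopes c)].

Definition is_cap (n : nat) c : Prop :=
  [/\ size c = n, sorted <%R (map fst c) & sorted >%R (slopes c)].

Definition cup_cap_free (n m : nat) S : Prop :=
  (forall c, is_cup n c -> ~ {subset c <= S}) /\
  (forall c, is_cap m c -> ~ {subset c <= S}).

Definition in_convex_hull X p : Prop :=
  exists w : R * R -> R,
    [/\ forall q, q \in X -> 0 <= w q,
        \sum_(q <- X) w q = 1,
        \sum_(q <- X) w q * q.1 = p.1 &
        \sum_(q <- X) w q * q.2 = p.2].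

(* The points of X are the vertices of a convex polygon. *)
Definition convex_position X : Prop :=
  forall p, p \in X -> ~ in_convex_hull (X `\ p) p.

(* Since 4 <= n, the list c below is nonempty, so the default value s of head
   and last is never used.  The set B consists of new points, and S `|` B is
   again a point set satisfying the standing assumption. *)
Definition good (m l : nat) S s : Prop :=
  forall (n : nat) B, (4 <= n)%N ->
    [disjoint S & B] -> (#|` B| <= n - 2)%N -> general_position (S `|` B) ->
    (exists c, [/\ is_cup (n - 1) c, {subset c <= S `|` B},
                   head s c = s & last s c \in B]) ->
    [\/ exists c, [/\ is_cap l c, {subset c <= S `|` B} &
                      {subset drop (l - 2) c <= S}],
        exists c, [/\ is_cup m c, {subset c <= S `|` B} &
                      {subset take 2 c <= S}] |
        exists X, [/\ X `<=` S `|` B, #|` X| = n & convex_position X]].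

End PointSets.

(* The subtractions are those of nat; for m, k >= 4 none of them is truncated
   (in the last line, k >= i). *)
Definition w (i m k : nat) : nat :=
  if i == 4 then
    'C(m + k - 6, k - 2) + 'C(m + k - 7, k - 3) + 2 * 'C(m + k - 8, k - 4)
  else if k < i then 0
  else (i - 1) * 'C(m + k - i - 4, k - i).

(* The sum over all i >= 4; it has finite support, see gE. *)
Definition g (m l : nat) : nat :=
  \big[addn/0]_(i \in [set i | 4 <= i]%classic) w i m l.

Lemma gE (m l N : nat) : 4 <= l < N -> g m l = \sum_(4 <= i < N) w i m l.
Proof.
case/andP=> l4 lN; have w0 i : l < i -> w i m l = 0.
  by move=> li; rewrite /w li; case: eqP => // i4; move: li; rewrite i4 ltnNge l4.
rewrite /g (fsbigE (index_iota 4 N)) ?iota_uniq//=.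
- rewrite big_seq_cond [RHS]big_seq; apply: eq_bigl => i.
  rewrite mem_index_iota; apply: andb_idr => /andP[i4 _]; exact: mem_set.
- by move=> i /=; rewrite mem_index_iota => /andP[].
- move=> i /= i4; rewrite mem_index_iota i4 /= -leqNgt => Ni.
  by apply: w0; apply: leq_trans Ni.
Qed.

(* Main.v *)
(* Call T extensible to the left (in S) if for all p, q in T with p left of q
   some r in S makes r, p, q a cup, and extensible to the right if some r in S
   makes p, q, r a cap.  If T is extensible to the left, it is (m-1,l)-free and
   an (m-1,l)-good point of T is (m,l)-good in S: the points of the adjoined
   cup outside T are few enough to play the role of B, and an (m-1)-cup whose
   two leftmost points are in T grows to an m-cup.  Symmetrically for caps.  Any
   S splits into a set extensible to the left and one extensible to the right:
   put p into the first when some slope from the left into p is smaller than all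
   slopes from p to the right.  If m, l > 4 then g(m,l) = g(m-1,l) + g(m,l-1), so
   induction applies to one of the parts.  When m = 4 the first part is a cap, of fewer
   than l points.  When l = 4 the second part is a cup; if it has m-1 points,
   its last but one point is good by a direct argument (lemma good4), which also
   settles m = l = 4. *)

Require Import Defs.
From mathcomp Require Import all_boot all_order all_algebra finmap reals.
From mathcomp Require Import ring lra zify.

Set Implicit Arguments.
Unset Strict Implicit.
Unset Printing Implicit Defensive.

Import Order.TTheory GRing.Theory Num.Theory.

(** * Recurrences and boundary values of [g] *)

(** Pascal's rule, applied to each binomial coefficient of [w] separately. *)
Lemma wD i m k : (4 <= i) -> (4 <= m) -> (4 <= k) ->
  w i m.+1 k.+1 = (w i m k.+1 + w i m.+1 k).
Proof.
move=> i4 m4 k4; have [a ->] : exists a, m = a.+4 by exists (m - 4); lia.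
have [b ->] : exists b, k = b.+4 by exists (k - 4); lia.
rewrite /w; case: eqP => [_|i4'].
  have -> : (a.+4.+1 + b.+4.+1 - 6 = (a + b).+3.+1) by lia.
  have -> : (a.+4.+1 + b.+4.+1 - 7 = (a + b).+2.+1) by lia.
  have -> : (a.+4.+1 + b.+4.+1 - 8 = (a + b).+1.+1) by lia.
  have -> : (a.+4 + b.+4.+1 - 6 = (a + b).+3) by lia.
  have -> : (a.+4 + b.+4.+1 - 7 = (a + b).+2) by lia.
  have -> : (a.+4 + b.+4.+1 - 8 = (a + b).+1) by lia.
  have -> : (a.+4.+1 + b.+4 - 6 = (a + b).+3) by lia.
  have -> : (a.+4.+1 + b.+4 - 7 = (a + b).+2) by lia.
  have -> : (a.+4.+1 + b.+4 - 8 = (a + b).+1) by lia.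
  rewrite !subSS !subn0 (binS _ b.+2) (binS _ b.+1) (binS _ b); lia.
have [ik|ki] := ltnP b.+4 i.
  have [ik'|ki'] := ltnP b.+4.+1 i; first by [].
  (* Boundary case: both terms at [b.+4.+1] equal [i - 1], and the one at [b.+4] vanishes. *)
  have -> : i = b.+4.+1 by lia.
  by rewrite !subnn !bin0; lia.
have [j ej] : exists j, b.+4 = (i + j) by exists (b.+4 - i); lia.
have -> : (b.+4.+1 < i) = false by lia.
have -> : (a.+4.+1 + b.+4.+1 - i - 4 = (a + j).+1.+1) by lia.
have -> : (a.+4 + b.+4.+1 - i - 4 = (a + j).+1) by lia.
have -> : (a.+4.+1 + b.+4 - i - 4 = (a + j).+1) by lia.
have -> : (b.+4.+1 - i = j.+1) by lia.
have -> : (b.+4 - i = j) by lia.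
by rewrite binS mulnDr addnC addnC.
Qed.

Lemma gD m l : (4 <= m) -> (4 <= l) -> g m.+1 l.+1 = (g m l.+1 + g m.+1 l).
Proof.
(* The cutoff [l.+2] lies beyond the supports of all three sums. *)
move=> m4 l4; rewrite !(@gE _ _ l.+2) ?l4 ?ltnS ?leqnSn ?(ltnW l4) //; try lia.
rewrite -big_split /= !big_nat; apply: eq_bigr => i /andP[i4 _].
exact: wD.
Qed.

(** For [m = 4] every binomial coefficient is 1, so only the new summand [i = l.+1] counts, and it
    is [l]. *)
Lemma g4S l : (4 <= l) -> g 4 l.+1 = (g 4 l + l).
Proof.
move=> l4; rewrite (@gE 4 l.+1 l.+2) ?(@gE 4 l l.+1); try lia.
rewrite big_nat_recr /=; last by lia.
congr addn; last first.
  rewrite /w; case: eqP => [?|_]; first by lia.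
  by rewrite ltnn !subnn bin0; lia.
apply: eq_big_nat => i /andP[i4 il]; rewrite /w; case: eqP => [_|_].
  have [b ->] : exists b, l = b.+4 by exists (l - 4); lia.
  have -> : (4 + b.+4.+1 - 6 = b.+3) by lia.
  have -> : (4 + b.+4.+1 - 7 = b.+2) by lia.
  have -> : (4 + b.+4.+1 - 8 = b.+1) by lia.
  have -> : (4 + b.+4 - 6 = b.+2) by lia.
  have -> : (4 + b.+4 - 7 = b.+1) by lia.
  have -> : (4 + b.+4 - 8 = b) by lia.
  by rewrite !subSS !subn0 !binn.
have -> : (l.+1 < i) = false by lia.
have -> : (l < i) = false by lia.
have -> : (4 + l.+1 - i - 4 = l.+1 - i) by lia.
have -> : (4 + l - i - 4 = l - i) by lia.
by rewrite !binn.
Qed.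

Lemma g_4E m : (4 <= m) -> g m 4 = 'C(m - 1, 2).+1.
Proof.
move=> m4; rewrite (@gE m 4 5) // big_nat1 /w /=.
have [a ->] : exists a, m = a.+4 by exists (m - 4); lia.
have -> : (a.+4 + 4 - 6 = a.+2) by lia.
have -> : (a.+4 + 4 - 7 = a.+1) by lia.
have -> : (a.+4 - 1 = a.+3) by lia.
by rewrite -[(4 - 2)]/2 bin1 bin0 (binS a.+2) bin1; lia.
Qed.

(** As in [g4S], the increment is the largest size of the part that the induction discards on this
    boundary. *)
Lemma gS4 m : (4 <= m) -> g m.+1 4 = (g m 4 + (m - 1)).
Proof.
move=> m4; rewrite !g_4E //; last by lia.
have [a ->] : exists a, m = a.+1 by exists (m - 1); lia.
by rewrite !subSS !subn0 binS bin1; lia.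
Qed.

Section CupsAndCaps.
Local Open Scope fset_scope.
Local Open Scope ring_scope.
Variable R : realType.
Implicit Types (p q r s x y z : R * R) (c d : seq (R * R)).
Implicit Types (S T B X : {fset R * R}).

(** * Slopes, general position and heights *)

Lemma slopeM x y : x.1 < y.1 -> slope x y * (y.1 - x.1) = y.2 - x.2.
Proof. by move=> xy; rewrite /slope divfK // subr_eq0 gt_eqF. Qed.

(** The slope of [xz] is a weighted mean of those of [xy] and [yz], with positive weights; this also
    gives the next two lemmas. *)
Lemma slope_lt_left x y z : x.1 < y.1 -> y.1 < z.1 ->
  (slope x y < slope x z) = (slope x y < slope y z).
Proof.
move=> xy yz; have xz := lt_trans xy yz.
have := slopeM xy; have := slopeM yz; have := slopeM xz.
by move=> *; apply/idP/idP => ?; nra.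
Qed.

Lemma slope_gt_left x y z : x.1 < y.1 -> y.1 < z.1 ->
  (slope x z < slope x y) = (slope y z < slope x y).
Proof.
move=> xy yz; have xz := lt_trans xy yz.
have := slopeM xy; have := slopeM yz; have := slopeM xz.
by move=> *; apply/idP/idP => ?; nra.
Qed.

Lemma slope_gt_right x y z : x.1 < y.1 -> y.1 < z.1 ->
  (slope y z < slope x z) = (slope y z < slope x y).
Proof.
move=> xy yz; have xz := lt_trans xy yz.
have := slopeM xy; have := slopeM yz; have := slopeM xz.
by move=> *; apply/idP/idP => ?; nra.
Qed.

Lemma general_position_sub S T :
  {subset T <= S} -> general_position S -> general_position T.
Proof.
move=> TS [ncol inj]; split=> [p q r /TS pS /TS qS /TS rS|p q /TS pS /TS qS].
  exact: ncol.
exact: inj.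
Qed.

Lemma general_position_slope S x y z : general_position S ->
  x \in S -> y \in S -> z \in S -> x.1 < y.1 -> y.1 < z.1 ->
  slope x y != slope y z.
Proof.
move=> [ncol _] xS yS zS xy yz; apply/eqP => e.
have xz := lt_trans xy yz.
apply: (ncol x y z) => //.
- by apply: contraTneq xy => ->; rewrite ltxx.
- by apply: contraTneq xz => ->; rewrite ltxx.
- by apply: contraTneq yz => ->; rewrite ltxx.
have := slopeM xy; have := slopeM yz; rewrite /collinear e => h1 h2; nra.
Qed.

(** Vertical offset from the line of slope [a] through the origin; where it is minimal on a set, a
    line of slope [a] supports the set from below. *)
Definition height (a : R) x : R := x.2 - a * x.1.

Lemma height_lt a x y : x.1 < y.1 -> (height a x < height a y) = (a < slope x y).
Proof.
move=> xy; have := slopeM xy; rewrite /height => h.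
by apply/idP/idP => ?; nra.
Qed.

Lemma height_gt a x y : x.1 < y.1 -> (height a y < height a x) = (slope x y < a).
Proof.
move=> xy; have := slopeM xy; rewrite /height => h.
by apply/idP/idP => ?; nra.
Qed.

(** * Adding and removing endpoints of cups and caps *)

Lemma slopes_rcons c x y :
  slopes (rcons (rcons c x) y) = rcons (slopes (rcons c x)) (slope x y).
Proof.
case: c => [|p c] //=.
by elim: c p => [|q c IH] p //=; rewrite IH.
Qed.

Lemma sorted_rcons2 (T : Type) (e : rel T) (c : seq T) (x y : T) :
  sorted e (rcons (rcons c x) y) = sorted e (rcons c x) && e x y.
Proof. by case: c => [|p c] /=; rewrite ?andbT // rcons_path last_rcons. Qed.

Lemma sorted_xs_rcons c x y :
  sorted <%R (map fst (rcons (rcons c x) y)) =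
  sorted <%R (map fst (rcons c x)) && (x.1 < y.1).
Proof. by rewrite !map_rcons sorted_rcons2. Qed.

Lemma is_cup_rcons n c x y z : y.1 < z.1 -> slope x y < slope y z ->
  is_cup n (rcons (rcons c x) y) -> is_cup n.+1 (rcons (rcons (rcons c x) y) z).
Proof.
move=> yz xyz [sc xc cc]; split; first by rewrite size_rcons sc.
  by rewrite sorted_xs_rcons xc.
by rewrite slopes_rcons slopes_rcons sorted_rcons2 -slopes_rcons cc /=.
Qed.

Lemma is_cap_rcons n c x y z : y.1 < z.1 -> slope y z < slope x y ->
  is_cap n (rcons (rcons c x) y) -> is_cap n.+1 (rcons (rcons (rcons c x) y) z).
Proof.
move=> yz xyz [sc xc cc]; split; first by rewrite size_rcons sc.
  by rewrite sorted_xs_rcons xc.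
by rewrite slopes_rcons slopes_rcons sorted_rcons2 -slopes_rcons cc /=.
Qed.

Lemma is_cup_belast n c x y :
  is_cup n.+1 (rcons (rcons c x) y) -> is_cup n (rcons c x).
Proof.
move=> [sc xc cc]; split.
- by move: sc; rewrite size_rcons => -[].
- by move: xc; rewrite sorted_xs_rcons => /andP[].
- case/lastP: c cc {sc xc} => [|c p] //.
  by rewrite slopes_rcons slopes_rcons sorted_rcons2 -slopes_rcons => /andP[].
Qed.

Lemma is_cup_cons n x y z c : x.1 < y.1 -> slope x y < slope y z ->
  is_cup n [:: y, z & c] -> is_cup n.+1 [:: x, y, z & c].
Proof. by move=> xy xyz [<- /= xc cc]; split; rewrite //= ?xy ?xyz. Qed.

(** * Supporting lines of cups and convex position *)

(** All slopes of the cup exceed [a], so [height a] increases along it. *)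
Lemma cup_first_below a p q c :
    sorted <%R (map fst [:: p, q & c]) -> sorted <%R (slopes [:: p, q & c]) ->
    a < slope p q ->
  {in q :: c, forall y, height a p < height a y}.
Proof.
elim: c p q => [|r c IH] p q /=.
  by move=> /andP[pq _] _ apq y; rewrite inE => /eqP->; rewrite height_lt.
move=> /and3P[pq qr xc] /andP[pqr cc] apq y; rewrite inE => /predU1P[->|yc].
  by rewrite height_lt.
apply: lt_trans (IH q r _ _ _ y yc); rewrite /= ?height_lt ?qr //.
exact: lt_trans pqr.
Qed.

(** A line through [x] whose slope lies between those of the incoming and outgoing edges supports
    the cup from below. *)
Lemma cup_support n c x : is_cup n c -> x \in c ->
  exists a, {in c, forall y, y != x -> height a x < height a y}.
Proof.
case: c => // p c [_].
(* Strengthened for induction on the cup: [b] exceeds a bound [a] given in advance. With the slope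
   of the removed edge as the bound, the removed head lies above its successor. *)
suff H a : sorted <%R (map fst (p :: c)) -> sorted <%R (slopes (p :: c)) ->
    (if c is q :: _ then a < slope p q else true) -> x \in p :: c ->
    exists2 b, a < b &
      {in p :: c, forall y, y != x -> height b x < height b y}.
  (* Any bound below the first slope will do; a single point has no slope and gets 0. *)
  move=> xc cc xpc; have [|b _ hb] := H (if c is q :: _ then slope p q - 1 else 0) xc cc _ xpc.
    by case: (c) => // q c'; rewrite ltrBlDr ltrDl.
  by exists b.
elim: c p a => [|q c IH] p a.
  move=> _ _ _; rewrite inE => /eqP ->; exists (a + 1); first by rewrite ltrDl.
  by move=> y; rewrite inE => ->.
move=> xc cc apq; rewrite inE => /predU1P[->|xqc].
  exists ((a + slope p q) / 2%:R); first by lra.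
  move=> y; rewrite inE => /orP[->//|yqc] _.
  by apply: cup_first_below xc cc _ _ yqc; lra.
have [|||b ab hb] := IH q (slope p q) _ _ _ xqc.
- by case/andP: xc.
- by case: (c) cc => //= r c' /andP[].
- by case: (c) cc => //= r c' /andP[].
exists b; first exact: lt_trans ab.
have pq : p.1 < q.1 by case/andP: xc.
move=> y; rewrite inE => /predU1P[-> _|]; last exact: hb.
have hq : height b q < height b p by rewrite height_gt.
have [<-//|qx] := eqVneq q x.
by apply: lt_trans hq; apply: hb => //; rewrite inE eqxx.
Qed.

(** The slope of a supporting line at [y] separates the two slopes. *)
Lemma cup_slope_lt n c x y z : is_cup n c -> x \in c -> y \in c -> z \in c ->
  x.1 < y.1 -> y.1 < z.1 -> slope x y < slope y z.
Proof.
move=> cc xc yc zc xy yz; have [a ha] := cup_support cc yc.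
apply: (@lt_trans _ _ a).
  by rewrite -height_gt //; apply: ha => //; apply: contraTneq xy => ->; rewrite ltxx.
by rewrite -height_lt //; apply: ha => //; apply: contraTneq yz => ->; rewrite ltxx.
Qed.

Lemma sorted_xs_uniq c : sorted <%R (map fst c) -> uniq c.
Proof. by rewrite lt_sorted_uniq_le => /andP[/map_uniq]. Qed.

Lemma sorted_xs_inj c : sorted <%R (map fst c) -> {in c &, injective fst}.
Proof.
elim: c => [|p c IH] //= xc x y; have minc := order_path_min lt_trans xc.
rewrite !inE => /predU1P[->|xc'] /predU1P[->|yc'] //.
- by move=> e; have /allP/(_ _ (map_f fst yc')) := minc; rewrite e ltxx.
- by move=> e; have /allP/(_ _ (map_f fst xc')) := minc; rewrite e ltxx.
- exact: IH (path_sorted xc) _ _ xc' yc'.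
Qed.

(** The weighted mean of the linear form [(u, v)] over [X] can equal its value at [p] only if all
    weights vanish, but they sum to 1. *)
Lemma notin_convex_hull (u v : R) X p :
    {in X, forall q, u * p.1 + v * p.2 < u * q.1 + v * q.2} ->
  ~ in_convex_hull X p.
Proof.
move=> Xp [w [w0 w1 wx wy]].
have /eqP : \sum_(q <- X) w q * ((u * q.1 + v * q.2) - (u * p.1 + v * p.2)) = 0.
  transitivity (u * \sum_(q <- X) w q * q.1 + v * \sum_(q <- X) w q * q.2
      - (u * p.1 + v * p.2) * \sum_(q <- X) w q); last by rewrite wx wy w1; ring.
  rewrite !mulr_sumr -big_split -sumrB /=; apply: eq_bigr => q _; ring.
rewrite big_seq psumr_eq0; last first.
  by move=> q qX; rewrite mulr_ge0 ?w0 // subr_ge0 ltW // Xp.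
move=> /allP wall; move: w1; rewrite big_seq big1 => [/eqP|q qX].
  by rewrite eq_sym oner_eq0.
have := wall _ qX; rewrite qX /= mulf_eq0 => /orP[/eqP//|].
by rewrite subr_eq0 gt_eqF // Xp.
Qed.

Lemma cup_convex_position n c : is_cup n c ->
  #|` [fset x in c]| = n /\ convex_position [fset x in c].
Proof.
move=> cc; have [sc xc _] := cc; split.
  by rewrite card_fseq undup_id // sorted_xs_uniq.
move=> p; rewrite inE => pc; have [a ha] := cup_support cc pc.
apply: (@notin_convex_hull (- a) 1) => q; rewrite !inE => /andP[qp qc].
by have := ha q qc qp; rewrite /height; lra.
Qed.

(** The chord [sb] separates [t] from the cup, and a supporting line at a point of the cup also has
    [t] above it, because [t] is above the chord. *)
Lemma cup_top_convex_position n c s b t :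
    is_cup n c -> s \in c -> b \in c -> {in c, forall x, s.1 <= x.1 <= b.1} ->
    s.1 < t.1 -> t.1 < b.1 -> slope s b < slope s t ->
  #|` [fset x in t :: c]| = n.+1 /\ convex_position [fset x in t :: c].
Proof.
move=> cc sc bc range st tb sbt; have [szc xc _] := cc.
have injc := sorted_xs_inj xc.
have tc : t \notin c.
  apply/negP => tc; have := cup_slope_lt cc sc tc bc st tb.
  by rewrite -slope_lt_left // ltNge (ltW sbt).
have sb := lt_trans st tb.
split.
  by rewrite card_fseq undup_id /= ?szc // tc sorted_xs_uniq.
move=> p; rewrite !inE => /predU1P[->|pc].
  (* The linear form is minus the height over the chord direction; the cup lies on or below the
     chord. *)
  apply: (@notin_convex_hull (slope s b) (- 1)) => q.
  rewrite !inE => /andP[/negPf qt]; rewrite qt /= => qc.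
  have ht : height (slope s b) s < height (slope s b) t by rewrite height_lt.
  have : height (slope s b) q <= height (slope s b) s.
    have [->//|qs] := eqVneq q s; have [->|qb'] := eqVneq q b.
      by have := slopeM sb; rewrite /height; lra.
    have /andP[sq qb] := range _ qc.
    have sq' : s.1 < q.1 by rewrite lt_neqAle sq andbT eq_sym (inj_in_eq injc).
    have qb1 : q.1 < b.1 by rewrite lt_neqAle qb andbT (inj_in_eq injc).
    by rewrite ltW // height_gt // slope_lt_left // (cup_slope_lt cc).
  by move: ht; rewrite /height; lra.
have [a ha] := cup_support cc pc.
have hle x : x \in c -> height a p <= height a x.
  by move=> ?; have [->//|?] := eqVneq x p; rewrite ltW // ha.
have ht : height a p < height a t.
  (* If [a] is below the slope of [st], then [t] is higher than [s]; otherwise [a] exceeds the slope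
     of [tb], and [t] is higher than [b]. *)
  have [ast|ast] := ltP a (slope s t).
    by apply: le_lt_trans (hle s sc) _; rewrite height_lt.
  apply: le_lt_trans (hle b bc) _; rewrite height_gt //.
  by apply: lt_le_trans ast; rewrite -slope_gt_left.
apply: (@notin_convex_hull (- a) 1) => q; rewrite !inE => /andP[qp /predU1P[->|qc]].
  by move: ht; rewrite /height; lra.
by have := ha q qc qp; rewrite /height; lra.
Qed.

(** * Triples of points and lists sorted by x-coordinate *)

Lemma general_position_lt_or S x y z : general_position S ->
  x \in S -> y \in S -> z \in S -> x.1 < y.1 -> y.1 < z.1 ->
  slope x y < slope y z \/ slope y z < slope x y.
Proof.
move=> gS xS yS zS xy yz.
by have := general_position_slope gS xS yS zS xy yz; case: ltgtP => //; [left|right].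
Qed.

Lemma slopes_sorted (e : rel R) c : sorted <%R (map fst c) ->
    (forall x y z, x \in c -> y \in c -> z \in c -> x.1 < y.1 -> y.1 < z.1 ->
       e (slope x y) (slope y z)) ->
  sorted e (slopes c).
Proof.
case: c => // p c; elim: c p => [|q [|r c] IH] p //.
move=> xc ec; have /and3P[pq qr xc'] := xc.
rewrite /= ec ?inE ?eqxx ?orbT //=; apply: IH; first by rewrite /= qr.
by move=> x y z xc1 yc1 zc1; apply: ec; rewrite inE ?xc1 ?yc1 ?zc1 orbT.
Qed.

Lemma sorted_xs_subset T k : {in T &, injective fst} -> (k <= #|` T|)%N ->
  exists c, [/\ size c = k, sorted <%R (map fst c) & {subset c <= T}].
Proof.
move=> injT kT; pose t := sort (relpre fst <=%R) T.
have tT : t =i T by move=> x; rewrite mem_sort.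
exists (take k t); split.
- by rewrite size_take size_sort; case: ltngtP kT.
- rewrite map_take; apply: take_sorted; rewrite lt_sorted_uniq_le.
  rewrite map_inj_in_uniq ?sort_uniq ?fset_uniq /=; last first.
    by move=> x y; rewrite !tT; apply: injT.
  by rewrite sorted_map; apply: sort_sorted => x y /=; apply: le_total.
- by move=> x /mem_take; rewrite tT.
Qed.

Lemma sorted_xs_head_le s c : sorted <%R (map fst c) ->
  {in c, forall x, (head s c).1 <= x.1}.
Proof.
case: c => // p c /=; rewrite lt_path_sortedE => /andP[/allP pc _] x.
by rewrite inE => /predU1P[->//|xc]; rewrite ltW // pc // map_f.
Qed.

Lemma sorted_xs_lt_last c b : sorted <%R (map fst (rcons c b)) ->
  {in c, forall x, x.1 < b.1}.
Proof.
rewrite map_rcons (sorted_pairwise lt_trans) pairwise_rcons => /andP[/allP cb _].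
by move=> x xc; apply: cb; rewrite map_f.
Qed.

Lemma take2_cat S c d : (2 <= size c)%N -> {subset c <= S} ->
  {subset take 2 (c ++ d) <= S}.
Proof. by move=> c2 cS x; rewrite takel_cat // => /mem_take/cS. Qed.

(** * Sufficient conditions for a point to be good *)

(** Let [b] end the adjoined cup [c]. Depending on where [b] lies relative to [p] and [q], points of
    [c] prolong the given cup to an [m]-cup, or [p] and [c] give a convex [n]-gon, or [p], [q] end a
    4-cap. *)
Lemma good4 m S d r s p q : general_position S ->
    is_cup (m - 1) (rcons (rcons (rcons d r) s) p) ->
    {subset rcons (rcons (rcons d r) s) p <= S} ->
    q \in S -> p.1 < q.1 -> slope p q < slope s p ->
  good m 4 S s.
Proof.
move=> gS cd dS qS pq spq n B n4 dSB _ gU [c [cc cU cs cB]].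
have SU x : x \in S -> x \in S `|` B by rewrite inE => ->.
have cmp := general_position_lt_or gU.
have [szd xd _] := cd.
have [pS sS rS] : [/\ p \in S, s \in S & r \in S].
  by split; apply: dS; rewrite !(mem_rcons, inE) eqxx ?orbT.
have /andP[/andP[_ rs] sp] : sorted <%R (map fst (rcons d r)) && (r.1 < s.1) && (s.1 < p.1).
  by rewrite -!sorted_xs_rcons.
have rsp : slope r s < slope s p.
  by apply: (cup_slope_lt cd); rewrite // !(mem_rcons, inE) eqxx ?orbT.
have em : m = (size d).+4 by move: szd; rewrite !size_rcons; lia.
have [k en] : exists k, n = k.+4 by exists (n - 4)%N; lia.
move: em cd cc => -> cd; rewrite en subn1 /=.
(* As [n - 1] is at least 3, [c] ends in three points [e'], [e], [b]; [s] may coincide with [e'],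
   but not with [e]. *)
case/lastP: c cs cB cU => [|c b]; first by move=> _ _ _ [].
case/lastP: c => [|c e]; first by move=> _ _ _ [].
case/lastP: c => [|c e'] cs; first by move=> _ _ [].
rewrite last_rcons => bB cU cc; have [_ xc _] := cc.
have sc : s \in rcons c e' by case: (c) cs => [|x c'] /= ->; rewrite inE eqxx.
have /andP[/andP[_ e'e] eb] : sorted <%R (map fst (rcons c e')) && (e'.1 < e.1) && (e.1 < b.1).
  by rewrite -!sorted_xs_rcons.
have [bc ec e'c] : [/\ b \in rcons (rcons (rcons c e') e) b,
   e \in rcons (rcons (rcons c e') e) b & e' \in rcons (rcons (rcons c e') e) b].
  by split; rewrite !(mem_rcons, inE) eqxx ?orbT.
have sce : s \in rcons (rcons c e') e by rewrite mem_rcons inE sc orbT.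
have scb : s \in rcons (rcons (rcons c e') e) b by rewrite mem_rcons inE sce orbT.
have sb : s.1 < b.1 by apply: (sorted_xs_lt_last xc).
have se : s.1 < e.1.
  have := xc; rewrite sorted_xs_rcons => /andP[xce _].
  exact: (sorted_xs_lt_last xce).
have headle := sorted_xs_head_le s xc; rewrite cs in headle.
have pb : p.1 != b.1.
  have [_ inj] := gU; rewrite (inj_in_eq inj (SU _ pS) (cU _ bc)).
  by apply: contraTneq bB => <-; have /fdisjointP/(_ _ pS) := dSB.
(* Used twice: for [p] above the chord [sb], and for [b] above the chord [sp]. *)
have top (t : R * R) c' x : t \in S `|` B -> is_cup k.+3 (rcons c' x) ->
    {subset rcons c' x <= S `|` B} -> s \in rcons c' x ->
    {in rcons c' x, forall y, s.1 <= y.1} -> s.1 < t.1 -> t.1 < x.1 ->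
    slope s x < slope s t ->
  exists X, [/\ X `<=` S `|` B, #|` X| = k.+4 & convex_position X].
  move=> tU cx xU sx hx st tx slx; have [_ xx _] := cx.
  have xlast : {in rcons c' x, forall y, s.1 <= y.1 <= x.1}.
    move=> y yx; apply/andP; split; first exact: hx.
    move: yx; rewrite mem_rcons inE => /predU1P[->|yc']; first exact: lexx.
    by rewrite ltW // (sorted_xs_lt_last xx).
  have xx' : x \in rcons c' x by rewrite mem_rcons inE eqxx.
  have [cardX convX] := cup_top_convex_position cx sx xx' xlast st tx slx.
  exists [fset y in t :: rcons c' x]; split=> //.
  by apply/fsubsetP => y; rewrite in_fset in_cons => /predU1P[->//|/xU].
have [bU eU e'U] : [/\ b \in S `|` B, e \in S `|` B & e' \in S `|` B].
  by split; apply: cU.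
case: (ltgtP p.1 b.1) pb => // pb _.
  (* p is left of b: it extends the cup d by b, or lies above the chord sb. *)
  have [spb|spb] := cmp s p b (SU _ sS) (SU _ pS) bU sp pb.
    apply: Or32; exists (rcons (rcons (rcons (rcons d r) s) p) b); split.
    - exact: is_cup_rcons.
    - by move=> x; rewrite mem_rcons inE => /predU1P[->//|/dS/SU].
    - by rewrite -cats1; apply: take2_cat => //; rewrite !size_rcons.
  apply: Or33; apply: (top p _ _ (SU _ pS) cc) => //.
  by rewrite slope_gt_left.
(* Now [b] is left of [p]; if [p] prolongs [c], the resulting [n]-cup is a convex [n]-gon. *)
have [ebp|ebp] := cmp e b p eU bU (SU _ pS) eb pb.
  have cp := is_cup_rcons pb ebp cc.
  have [cardX convX] := cup_convex_position cp.
  apply: Or33; exists [fset x in rcons (rcons (rcons (rcons c e') e) b) p]; split=> //.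
  by apply/fsubsetP => y; rewrite in_fset mem_rcons in_cons => /predU1P[->|/cU //]; apply: SU.
(* Now e, b, p is a cap, and so is e, b, p, q unless b is above the line pq. *)
have dropS (x y : R * R) : {subset drop (4 - 2) [:: x; y; p; q] <= S}.
  by move=> z; rewrite !inE => /orP[] /eqP->.
have [bpq|bpq] := cmp b p q bU (SU _ pS) (SU _ qS) pb pq; last first.
  apply: Or31; exists [:: e; b; p; q]; split=> //.
    by split; rewrite //= ?eb ?pb ?pq ?ebp ?bpq.
  by move=> x; rewrite !(in_cons, in_nil) orbF => /or4P[] /eqP-> //; apply: SU.
have sbp : slope b p < slope s b by rewrite -slope_gt_right // (lt_trans bpq).
have spsb : slope s p < slope s b by rewrite slope_gt_left.
have ep := lt_trans eb pb.
(* If e is also above the line pq then s, e, b prolongs d minus p; otherwise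
   either e', e, p, q is a cap or p can take the place of b in the cup c, with b
   above the chord sp. *)
have [epq|epq] := cmp e p q eU (SU _ pS) (SU _ qS) ep pq.
  have sep : slope e p < slope s e by rewrite -slope_gt_right // (lt_trans epq).
  (* Since [e] is above the chord [sp], the edge [se] is steeper than [sp], so it can follow
     [rs]. *)
  have rse : slope r s < slope s e.
    by apply: lt_trans rsp _; rewrite slope_gt_left.
  apply: Or32; exists (rcons (rcons (rcons (rcons d r) s) e) b); split.
  - apply: is_cup_rcons => //; first exact: (cup_slope_lt cc).
    by apply: is_cup_rcons => //; apply: is_cup_belast cd.
  - move=> x; rewrite mem_rcons inE => /predU1P[->//|].
    rewrite mem_rcons inE => /predU1P[->//|xd'].
    by apply/SU/dS; rewrite mem_rcons inE xd' orbT.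
  - rewrite -!cats1 -catA !cats1; apply: take2_cat; first by rewrite !size_rcons.
    by move=> x xd'; apply: dS; rewrite mem_rcons inE xd' orbT.
have [e'ep|e'ep] := cmp e' e p e'U eU (SU _ pS) e'e ep; last first.
  apply: Or31; exists [:: e'; e; p; q]; split=> //.
    by split; rewrite //= ?e'e ?ep ?pq ?e'ep ?epq.
  by move=> x; rewrite !(in_cons, in_nil) orbF => /or4P[] /eqP-> //; apply: SU.
apply: Or33; apply: (top b (rcons (rcons c e') e) p) => //.
- by apply: is_cup_rcons => //; apply: is_cup_belast cc.
- move=> x; rewrite mem_rcons inE => /predU1P[->|xc']; first exact: SU.
  by apply: cU; rewrite mem_rcons inE xc' orbT.
- by rewrite mem_rcons inE sce orbT.
- move=> x; rewrite mem_rcons inE => /predU1P[->|xc']; first exact: ltW.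
  by apply: headle; rewrite mem_rcons inE xc' orbT.
Qed.

(* The set adjoined to T is the given cup minus T: it has at most n - 2 points
   since s is in T. *)
Lemma good_ext m l m' l' T S s : {subset T <= S} -> s \in T ->
    (forall (U : {fset R * R}) c, {subset S <= U} -> is_cap l' c -> {subset c <= U} ->
       {subset drop (l' - 2) c <= T} ->
       exists d, [/\ is_cap l d, {subset d <= U} & {subset drop (l - 2) d <= S}]) ->
    (forall (U : {fset R * R}) c, {subset S <= U} -> is_cup m' c -> {subset c <= U} ->
       {subset take 2 c <= T} ->
       exists d, [/\ is_cup m d, {subset d <= U} & {subset take 2 d <= S}]) ->
  good m' l' T s -> good m l S s.
Proof.
move=> TS sT capTS cupTS goodT n B n4 dSB _ gU [c [cc cU cs cB]].
pose C : {fset R * R} := [fset x in c]; pose B' := C `\` T.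
have SU x : x \in S -> x \in S `|` B by rewrite inE => ->.
have TU : {subset T `|` B' <= S `|` B}.
  by move=> x; rewrite !in_fsetE => /orP[/TS->//|/andP[_ /cU]]; rewrite in_fsetE.
have [szc xc _] := cc.
have sc : s \in c by case: (c) cs szc => [_ /=|x c' /= <- _]; [lia|rewrite inE eqxx].
have [||||||] := goodT n B' n4.
- by apply/fdisjointP => x xT; rewrite !in_fsetE xT.
- have -> : B' = C `\` (T `&` C).
    by apply/fsetP => x; rewrite !in_fsetE; case: (x \in c); rewrite ?andbF ?andbT.
  rewrite cardfsDS ?fsubsetIr // card_fseq undup_id ?sorted_xs_uniq // szc.
  have : (0 < #|` T `&` C|)%N.
    by rewrite cardfs_gt0; apply/fset0Pn; exists s; rewrite !in_fsetE sT.
  lia.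
- exact: general_position_sub gU.
- exists c; split=> //.
    by move=> x xc'; rewrite !in_fsetE xc' andbT orbN.
  (* The right endpoint is in [B], which is disjoint from [S], so it remains among the adjoined
     points. *)
  have lS : last s c \notin T.
    by apply: contraTN cB => /TS; move/fdisjointP: dSB; apply.
  rewrite !in_fsetE lS /=; case: (c) sc => // x c' _ /=; exact: mem_last.
- move=> [d [cd dU dT]]; apply: Or31; apply: capTS cd _ dT => // x /dU; exact: TU.
- move=> [d [cd dU dT]]; apply: Or32; apply: cupTS cd _ dT => // x /dU; exact: TU.
- move=> [X [XU Xn Xc]]; apply: Or33; exists X; split=> //.
  by apply: fsubset_trans XU _; apply/fsubsetP.
Qed.

(** * Extensible sets and the passage from them to [S] *)

Definition cup_extensible T S := forall p q, p \in T -> q \in T -> p.1 < q.1 ->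
  exists r, [/\ r \in S, r.1 < p.1 & slope r p < slope p q].

Definition cap_extensible T S := forall p q, p \in T -> q \in T -> p.1 < q.1 ->
  exists r, [/\ r \in S, q.1 < r.1 & slope q r < slope p q].

Lemma extensible_partition S : general_position S ->
  exists T, [/\ {subset T <= S}, cup_extensible T S & cap_extensible (S `\` T) S].
Proof.
move=> gS.
pose P p := has (fun r => (r.1 < p.1) &&
  all (fun q => (p.1 < q.1) ==> (slope r p < slope p q)) S) S.
have inT p : (p \in [fset p in S | P p]) = (p \in S) && P p by rewrite !inE.
exists [fset p in S | P p]; split.
- by move=> p; rewrite inT => /andP[].
- move=> p q; rewrite !inT => /andP[pS /hasP[r rS /andP[rp /allP rpq]]] /andP[qS _] pq.
  by exists r; split=> //; have := rpq q qS; rewrite pq.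
- move=> p q; rewrite !in_fsetD !inT => /andP[_ pS] /andP[+ qS] pq.
  (* As [q] fails the test, the slope from [p] into [q] is not below all slopes out of [q]; general
     position makes the failure strict. *)
  rewrite qS /= => /hasPn/(_ _ pS); rewrite pq /= => /allPn[r rS].
  rewrite negb_imply => /andP[qr npqr]; exists r; split=> //.
  by have [pqr|//] := general_position_lt_or gS pS qS rS pq qr; rewrite pqr in npqr.
Qed.

(** The first edge alone decides which points can be prepended, so the rest of [c] may lie outside
    [T], as the adjoined points do. *)
Lemma is_cup_extend T S m c : cup_extensible T S -> (2 <= m)%N ->
    is_cup m c -> {subset take 2 c <= T} ->
  exists r, [/\ r \in S, is_cup m.+1 (r :: c) &
                {subset take 2 (r :: c) <= r |` T}].
Proof.
move=> ext m2 cc; have [szc xc _] := cc.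
case: c cc szc xc => [|p [|q c]] cc szc xc; try by move: m2; rewrite -szc.
rewrite /= take0 => cT; have pq : p.1 < q.1 by case/andP: xc.
have [||r [rS rp rpq]] := ext p q _ _ pq; try by apply: cT; rewrite !inE eqxx ?orbT.
exists r; split=> //; first exact: is_cup_cons.
by move=> x; rewrite !inE => /orP[->//|/eqP->]; rewrite cT ?orbT // inE eqxx.
Qed.

Lemma is_cap_extend T S l c : cap_extensible T S -> (2 <= l)%N ->
    is_cap l c -> {subset drop (l - 2) c <= T} ->
  exists r, [/\ r \in S, is_cap l.+1 (rcons c r) &
                {subset drop (l.+1 - 2) (rcons c r) <= r |` T}].
Proof.
move=> ext l2 cc; have [szc xc _] := cc.
case/lastP: c cc szc xc => [|c q]; first by move=> _ szc; rewrite -szc in l2.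
case/lastP: c => [|c p] cc szc xc; first by rewrite -szc in l2.
have el : l = (size c).+2 by rewrite -szc !size_rcons.
have pq : p.1 < q.1 by move: xc; rewrite sorted_xs_rcons => /andP[].
move=> cT; have pqT : {subset [:: p; q] <= T}.
  by move: cT; rewrite el !subSS subn0 -!cats1 -catA drop_size_cat.
have [||r [rS qr pqr]] := ext p q _ _ pq; try by apply: pqT; rewrite !inE eqxx ?orbT.
exists r; split=> //; first exact: is_cap_rcons.
have -> : rcons (rcons (rcons c p) q) r = rcons c p ++ [:: q; r].
  by rewrite -!cats1 -!catA.
rewrite el !subSS subn0 drop_size_cat ?size_rcons // => x.
by rewrite !inE => /orP[]/eqP->; rewrite ?eqxx // pqT ?orbT // !inE eqxx orbT.
Qed.

Definition has_good m l S := exists s,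
  [/\ s \in S, good m l S s &
      exists c, [/\ is_cap (l - 1) c, {subset c <= S} & head s c = s]].

Lemma cup_free_extensible m l T S : {subset T <= S} -> cup_extensible T S ->
  (2 <= m)%N -> cup_cap_free m.+1 l S -> cup_cap_free m l T.
Proof.
move=> TS ext m2 [cupS capS]; split=> c cc cT; last first.
  by apply: capS cc _ => x /cT/TS.
have [r [rS cr _]] := is_cup_extend ext m2 cc (fun x xc => cT x (mem_take xc)).
by apply: cupS cr _ => x; rewrite inE => /predU1P[->//|/cT/TS].
Qed.

Lemma cap_free_extensible m l T S : {subset T <= S} -> cap_extensible T S ->
  (2 <= l)%N -> cup_cap_free m l.+1 S -> cup_cap_free m l T.
Proof.
move=> TS ext l2 [cupS capS]; split=> c cc cT.
  by apply: cupS cc _ => x /cT/TS.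
have [r [rS cr _]] := is_cap_extend ext l2 cc (fun x xc => cT x (mem_drop xc)).
by apply: capS cr _ => x; rewrite mem_rcons inE => /predU1P[->//|/cT/TS].
Qed.

Lemma has_good_cup_extensible m l T S : {subset T <= S} -> cup_extensible T S ->
  (2 <= m)%N -> has_good m l T -> has_good m.+1 l S.
Proof.
move=> TS ext m2 [s [sT goods [c [cc cT cs]]]]; exists s; split; first exact: TS.
- apply: good_ext goods => // U d SU cd dU dT.
    by exists d; split=> // x /dT/TS.
  have [r [rS cr rT]] := is_cup_extend ext m2 cd dT.
  exists (r :: d); split=> // x; first by rewrite inE => /predU1P[->|/dU//]; apply: SU.
  by move=> /rT; rewrite in_fset1U => /predU1P[->//|/TS].
- by exists c; split=> // x /cT/TS.
Qed.

Lemma has_good_cap_extensible m l T S : {subset T <= S} -> cap_extensible T S ->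
  (3 <= l)%N -> has_good m l T -> has_good m l.+1 S.
Proof.
move=> TS ext l3 [s [sT goods [c [cc cT cs]]]]; exists s; split; first exact: TS.
- apply: good_ext goods => // U d SU cd dU dT; last by exists d; split=> // x /dT/TS.
  have [r [rS cr rT]] := is_cap_extend ext (ltnW l3) cd dT.
  exists (rcons d r); split=> // x.
    by rewrite mem_rcons inE => /predU1P[->|/dU//]; apply: SU.
  by move=> /rT; rewrite in_fset1U => /predU1P[->//|/TS].
(* The cap grows at its right end, so [s] stays its left endpoint. *)
- have l1 : (2 <= l - 1)%N by lia.
  have [r [rS cr _]] := is_cap_extend ext l1 cc (fun x xc => cT x (mem_drop xc)).
  exists (rcons c r); split.
  + by rewrite subSS subn0; have -> : l = (l - 1).+1 by lia.
  + by move=> x; rewrite mem_rcons inE => /predU1P[->//|/cT/TS].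
  + by have [szc _ _] := cc; case: (c) cs szc => [_ /= ?|//]; lia.
Qed.

(** * Boundary cases and the induction on [m + l] *)

(** Without 3-cups every triple is a cap, so any [l] points would form an [l]-cap. *)
Lemma cup_free3_card l T : general_position T -> cup_cap_free 3 l T -> (#|` T| < l)%N.
Proof.
move=> gT [cup cap]; rewrite ltnNge; apply/negP => lT.
have [c [szc xc cT]] := sorted_xs_subset gT.2 lT.
apply: (cap c) => //; split=> //; apply: slopes_sorted xc _ => x y z xC yC zC xy yz.
have [xyz|//] := general_position_lt_or gT (cT _ xC) (cT _ yC) (cT _ zC) xy yz.
case: (cup [:: x; y; z]); first by split; rewrite //= ?xy ?yz ?xyz.
by move=> u; rewrite !inE => /or3P[] /eqP->; apply: cT.
Qed.

(** A 3-cap in [T] would extend to a 4-cap in [S], so [m - 1] points of [T] form a cup. Extending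
    its last edge [sp] by [q] gives the setting of [good4] and the required 3-cap at once. *)
Lemma has_good_cup m T S : general_position S -> (4 <= m)%N -> {subset T <= S} ->
    cap_extensible T S -> cup_cap_free m 4 S -> (m - 1 <= #|` T|)%N ->
  has_good m 4 S.
Proof.
move=> gS m4 TS ext freeS mT.
have gT := general_position_sub TS gS.
have [_ capT] := @cap_free_extensible m 3 T S TS ext isT freeS.
have [c [szc xc cT]] := sorted_xs_subset gT.2 mT.
have cc : is_cup (m - 1) c.
  split=> //; apply: slopes_sorted xc _ => x y z xC yC zC xy yz.
  have [//|xyz] := general_position_lt_or gT (cT _ xC) (cT _ yC) (cT _ zC) xy yz.
  case: (capT [:: x; y; z]); first by split; rewrite //= ?xy ?yz ?xyz.
  by move=> u; rewrite !inE => /or3P[] /eqP->; apply: cT.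
case/lastP: c szc xc cT cc => [|c p]; first by move=> /=; lia.
case/lastP: c => [|c s]; first by move=> /=; lia.
case/lastP: c => [|c r] szc xc cT cc; first by move: szc => /=; lia.
have /andP[_ sp] : sorted <%R (map fst (rcons (rcons c r) s)) && (s.1 < p.1).
  by rewrite -sorted_xs_rcons.
have [pT sT] : p \in T /\ s \in T.
  by split; apply: cT; rewrite !(mem_rcons, inE) eqxx ?orbT.
have [q [qS pq spq]] := ext s p sT pT sp.
exists s; split; first exact: TS.
  by apply: good4 gS cc _ qS pq spq => x /cT/TS.
exists [:: s; p; q]; split=> //; first by split; rewrite //= ?sp ?pq ?spq.
by move=> x; rewrite !inE => /or3P[] /eqP-> //; apply: TS.
Qed.

(** Here [T] has no 3-cup, so three of its points form the cap; extending its first edge to the left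
    yields the 3-cup that [good4] needs, with [d] empty. *)
Lemma has_good44 T S : general_position S -> {subset T <= S} ->
    cup_extensible T S -> cup_cap_free 4 4 S -> (3 <= #|` T|)%N ->
  has_good 4 4 S.
Proof.
move=> gS TS ext freeS mT.
have gT := general_position_sub TS gS.
have [cupT _] := @cup_free_extensible 3 4 T S TS ext isT freeS.
have [[|s [|p [|q [|? ?]]]] [//= _ /and3P[sp pq _] cT]] := sorted_xs_subset gT.2 mT.
have [sT pT qT] : [/\ s \in T, p \in T & q \in T].
  by split; apply: cT; rewrite !inE eqxx ?orbT.
have spq : slope p q < slope s p.
  have [spq|//] := general_position_lt_or gT sT pT qT sp pq.
  by case: (cupT [:: s; p; q]) => //; split; rewrite //= ?sp ?pq ?spq.
have [r [rS rs rsp]] := ext s p sT pT sp.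
exists s; split; first exact: TS.
  apply: (good4 (d := [::]) (r := r) (p := p) (q := q)) => //; last exact: TS.
    by split; rewrite //= ?rs ?sp ?rsp.
  by move=> x; rewrite !inE => /or3P[] /eqP-> //; apply: TS.
exists [:: s; p; q]; split=> //; first by split; rewrite //= ?sp ?pq ?spq.
by move=> x /cT/TS.
Qed.

Lemma has_good_card m l S : (4 <= m)%N -> (4 <= l)%N -> general_position S ->
  cup_cap_free m l S -> (g m l < #|` S|)%N -> has_good m l S.
Proof.
have [N] := ubnP (m + l)%N; elim: N m l S => // N IH m l S mlN m4 l4 gS freeS cardS.
have [T [TS cupT capU]] := extensible_partition gS.
set U := S `\` T in capU.
have US : {subset U <= S} by move=> x; rewrite in_fsetD => /andP[].
have gT := general_position_sub TS gS; have gU := general_position_sub US gS.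
have cardE : #|` S| = (#|` T| + #|` U|)%N.
  rewrite cardfsDS; last exact/fsubsetP.
  by rewrite subnKC // fsubset_leq_card //; apply/fsubsetP.
have [m4' | [m' [em m4']]] : m = 4%N \/ exists m', m = m'.+1 /\ (4 <= m')%N.
- by case: (ltngtP m 4%N) m4 => // m5 _; [right; exists m.-1; split; lia | left].
- have [l4' | [l' [el l4']]] : l = 4%N \/ exists l', l = l'.+1 /\ (4 <= l')%N.
    by case: (ltngtP l 4%N) l4 => // l5 _; [right; exists l.-1; split; lia | left].
  + subst m l; have [T3|T3] := leqP 3%N #|` T|; first exact: has_good44 TS cupT freeS T3.
    (* [T] has at most 2 points and [g 4 4] is 4, so at least 3 points are left for [U]. *)
    apply: (has_good_cup gS _ US capU freeS) => //.
    by move: cardS; rewrite g_4E //; have -> : 'C(4 - 1, 2) = 3%N by []; lia.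
  + subst m l; have /(cup_free3_card gT) cardT := @cup_free_extensible 3 _ T S TS cupT isT freeS.
    (* [T] has at most [l'] points, the increment in [g4S]. *)
    apply: (has_good_cap_extensible US capU); first by lia.
    apply: IH => //; [apply: (cap_free_extensible US capU _ freeS); lia |].
    by move: cardS; rewrite g4S //; lia.
subst m; have [l4' | [l' [el l4']]] : l = 4%N \/ exists l', l = l'.+1 /\ (4 <= l')%N.
- by case: (ltngtP l 4%N) l4 => // l5 _; [right; exists l.-1; split; lia | left].
- subst l; have [Um|Um] := leqP (m'.+1 - 1) #|` U|.
    exact: has_good_cup US capU freeS Um.
  (* [U] has at most [m' - 1] points, the increment in [gS4]. *)
  apply: (has_good_cup_extensible TS cupT); first by lia.
  apply: IH => //; [apply: (cup_free_extensible TS cupT _ freeS); lia |].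
  by move: cardS; rewrite gS4 //; lia.
subst l; have [Tg|Tg] := ltnP (g m' l'.+1) #|` T|.
  apply: (has_good_cup_extensible TS cupT); first by lia.
  by apply: IH => //; apply: (cup_free_extensible TS cupT _ freeS); lia.
apply: (has_good_cap_extensible US capU); first by lia.
apply: IH => //; [by lia | apply: (cap_free_extensible US capU _ freeS); lia |].
by move: cardS; rewrite gD //; lia.
Qed.

End CupsAndCaps.

Theorem theorem3 (R : realType) (m l : nat) (hm : (4 <= m)%N) (hl : (4 <= l)%N)
    (S : {fset R * R}) (Sgen : general_position S) (Sfree : cup_cap_free m l S)
    (Scard : (g m l < #|` S|)%N) :
  exists s : R * R,
    [/\ s \in S, good m l S s &
        exists c : seq (R * R),
          [/\ is_cap (l - 1) c, {subset c <= S} & head s c = s]].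
Proof. exact: has_good_card. Qed.
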